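(* Let $n\ge 2$, $k\ge 2$ be integers. Any run of a policy iteration (PI) algorithm with max-gain action selection on an $n$-state, $k$-action deterministic MDP terminates in at most $$(n+1)\,n^2\,k\,\big((k+1)!\big)^{(n-1)/(k+1)} = O\!\left(n^3\left(\Big(1+O\big(\tfrac{\log k}{k}\big)\Big)\frac{k}{e}\right)^n\right)$$ steps.
   Context: A (finite, discounted) MDP is a tuple $(S,A,T,R,\gamma)$ with finite state set $S$, $|S|=n\ge 2$; finite action set $A$, $|A|=k\ge 2$ (all actions available at every state); transition function $T:S\times A\times S\to[0,1]$ with $\sum_{s'}T(s,a,s')=1$; reward function $R:S\times A\to\mathbb R$; and discount factor $\gamma\in[0,1)$. It is deterministic (a DMDP) if $T$ takes values in $\{0,1\}$. A policy is a map $\pi:S\to A$. Its value function $V^\pi:S\to\mathbb R$ is the unique solution of $V^\pi(s)=R(s,\pi(s))+\gamma\sum_{s'}T(s,\pi(s),s')V^\pi(s')$. The action value function is $Q^\pi(s,a)=R(s,a)+\gamma\sum_{s'}T(s,a,s')V^\pi(s')$ and the gain is $\rho^\pi(s,a)=Q^\pi(s,a)-V^\pi(s)$. The improvable set is $I^\pi=\{(s,a):\rho^\pi(s,a)>0\}$. A valid improvement set is a nonempty $I\subseteq I^\pi$ containing at most one pair $(s,a)$ for each $s\in S$. A policy improvement step from $\pi$ using $I$ yields the policy $\pi'$ with $\pi'(s)=a$ if $(s,a)\in I$ and $\pi'(s)=\pi(s)$ otherwise. The step uses max-gain action selection if for each $(s,a)\in I$, the action $a$ maximises $\rho^\pi(s,\cdot)$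 over all actions (ties broken arbitrarily); the set of states at which switches are made is unrestricted. A run of a PI algorithm with max-gain action selection is a sequence of policies $\pi_1,\pi_2,\dots,\pi_\ell$ in which $\pi_1$ is an arbitrary initial policy, each $\pi_{i+1}$ is obtained from $\pi_i$ by a policy improvement step with max-gain action selection, and which stops once $I^{\pi_\ell}=\emptyset$ (equivalently, $\pi_\ell$ is optimal). The number of steps of the run is counted as the number $\ell$ of policies in the sequence. The asymptotic expression means: there are absolute constants $C,c>0$ such that the displayed quantity is at most $C\,n^3\big((1+c\frac{\log k}{k})\frac{k}{e}\big)^n$ for all $n,k\ge 2$. *)

(* Defs.v *)
From HB Require Import structures.
From mathcomp Require Import all_boot all_order all_algebra.
From mathcomp Require Import boolp reals exp.
From mathcomp Require classical_sets.

Set Implicit Arguments.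
Unset Strict Implicit.
Unset Printing Implicit Defensive.

Import Order.TTheory GRing.Theory Num.Theory.

Local Open Scope ring_scope.

Record mdp (R : realType) (S A : finType) := Mdp {
  trans : S -> A -> S -> R;
  reward : S -> A -> R;
  discount : R;
  trans_ge0 : forall s a s', 0 <= trans s a s';
  trans_le1 : forall s a s', trans s a s' <= 1;
  trans_sum1 : forall s a, \sum_(s' : S) trans s a s' = 1;
  discount_ge0 : 0 <= discount;
  discount_lt1 : discount < 1
}.

Definition policy (S A : finType) : finType := {ffun S -> A}.

Section PolicyIteration.
Variables (R : realType) (S A : finType).
Implicit Types (M : mdp R S A) (pi : policy S A) (V : S -> R).
Implicit Types (I : {set S * A}).

Definition deterministic M : Prop :=
  forall s a s', trans M s a s' = 0 \/ trans M s a s' = 1.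

Definition backup M V (s : S) (a : A) : R :=
  reward M s a + discount M * \sum_(s' : S) trans M s a s' * V s'.

Definition is_value M pi V : Prop := forall s, V s = backup M V s (pi s).

(* The default [fun=> 0] is never used: [is_value M pi] has exactly one
   solution, see [is_valueE]. *)
Definition value M pi : S -> R := classical_sets.xget (fun=> 0) (is_value M pi).

Definition qvalue M pi (s : S) (a : A) : R := backup M (value M pi) s a.

Definition gain M pi (s : S) (a : A) : R := qvalue M pi s a - value M pi s.

Definition improvable M pi : {set S * A} :=
  [set x : S * A | 0 < gain M pi x.1 x.2].

Definition valid_improvement M pi I : Prop :=
  [/\ I != set0, I \subset improvable M pi
    & forall s a b, (s, a) \in I -> (s, b) \in I -> a = b].

Definition switch pi I : policy S A :=
  [ffun s => odflt (pi s) [pick a | (s, a) \in I]].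

Definition max_gain M pi I : Prop :=
  forall s a, (s, a) \in I -> forall b, gain M pi s b <= gain M pi s a.

Definition max_gain_step M pi pi' : Prop :=
  exists I, [/\ valid_improvement M pi I, max_gain M pi I & pi' = switch pi I].

Inductive max_gain_run M : seq (policy S A) -> Prop :=
| RunStop pi : improvable M pi = set0 -> max_gain_run M [:: pi]
| RunStep pi pi' s : max_gain_step M pi pi' -> max_gain_run M (pi' :: s) ->
    max_gain_run M [:: pi, pi' & s].

Lemma contraction_eq0 M pi V :
    (forall s, V s = discount M * \sum_s' trans M s (pi s) s' * V s') ->
  V =1 fun=> 0.
Proof.
move=> HV s0.
have [s _ smax] := Order.TotalTheory.arg_maxP (P := predT) (fun s => `|V s|) (erefl : predT s0).
suff Vs0 : `|V s| <= 0.
  by apply/eqP; rewrite -normr_le0 (le_trans (smax s0 isT)).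
have h : `|V s| <= discount M * `|V s|.
  rewrite {1}HV normrM (ger0_norm (discount_ge0 M)).
  apply: ler_wpM2l; first exact: discount_ge0.
  apply: (le_trans (ler_norm_sum _ _ _)).
  rewrite -[leRHS]mul1r -(trans_sum1 M s (pi s)) mulr_suml.
  apply: ler_sum => t _; rewrite normrM (ger0_norm (trans_ge0 _ _ _ _)).
  by apply: ler_wpM2l; [exact: trans_ge0 | exact: smax].
have := discount_lt1 M; rewrite -subr_gt0 => h1.
by rewrite -(pmulr_rle0 _ h1) mulrBl mul1r subr_le0.
Qed.

Lemma is_value_uniq M pi V W : is_value M pi V -> is_value M pi W -> V = W.
Proof.
move=> hV hW; apply/funext => s; apply/eqP; rewrite -subr_eq0; apply/eqP.
apply: (@contraction_eq0 M pi (fun s => V s - W s)) => {}s.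
rewrite {1}hV {1}hW /backup opprD addrACA subrr add0r -mulrBr -sumrB.
by congr (_ * _); apply: eq_bigr => t _; rewrite mulrBr.
Qed.

Lemma is_value_ex M pi : exists V, is_value M pi V.
Proof.
pose N := #|S|.
pose B : 'M[R]_N := \matrix_(i, j) (discount M *
  trans M (enum_val j) (pi (enum_val j)) (enum_val i)).
pose r : 'rV[R]_N := \row_j reward M (enum_val j) (pi (enum_val j)).
have BE (v : 'rV[R]_N) s : (v *m B) 0 (enum_rank s) =
    discount M * \sum_s' trans M s (pi s) s' * v 0 (enum_rank s').
  rewrite mxE (reindex enum_rank) /=; last first.
    by exists enum_val => i _; rewrite ?enum_rankK ?enum_valK.
  rewrite mulr_sumr; apply: eq_bigr => s' _.
  by rewrite !mxE !enum_rankK mulrC mulrA.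
have uB : (1%:M - B) \in unitmx.
  rewrite -row_free_unit -kermx_eq0; apply/rowV0P => v /sub_kermxP.
  rewrite mulmxBr mulmx1 => /eqP; rewrite subr_eq0 => /eqP vE.
  apply/rowP => j; rewrite mxE -[j]enum_valK.
  apply: (@contraction_eq0 M pi (fun s => v 0 (enum_rank s))) => s.
  by rewrite {1}vE BE.
pose v := r *m invmx (1%:M - B).
have vE : v = r + v *m B.
  by apply/eqP; rewrite -subr_eq -{1}[v]mulmx1 -mulmxBr mulmxKV.
exists (fun s => v 0 (enum_rank s)) => s.
by rewrite {1}vE mxE BE mxE enum_rankK.
Qed.

Lemma is_valueE M pi V : is_value M pi V <-> V = value M pi.
Proof.
have vP : is_value M pi (value M pi).
  have [W hW] := is_value_ex M pi.
  exact: (classical_sets.xgetI _ hW).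
by split=> [hV|-> //]; exact: is_value_uniq hV vP.
Qed.

End PolicyIteration.

Definition step_bound (R : realType) (n k : nat) : R :=
  (n%:R + 1) * n%:R ^+ 2 * k%:R *
  (k.+1)`!%:R `^ ((n%:R - 1) / (k%:R + 1)).

(* Main.v *)
(* A policy of a deterministic MDP sends each state s along a simple path to a
   last state t, whose action then leads back into the path; this path and
   the closing action determine the value of s. Max-gain switching only ever
   installs an action of largest reward among those with the same successor,
   so as long as the set of states carrying such actions does not change, the
   rewards along the path are determined by the path itself. Values never
   decrease and each step increases one of them, so each phase has at most
   one step per triple (s, path, closing action), and there are at most n + 1
   phases. Closing the path by t -> s and fixing all other states gives a
   permutation supported on a 0/1 matrix whose row t has one entry and whose
   other rows have at most k + 1 entries, so the Bregman-Minc bound on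
   permanents allows at most ((k+1)!)^((n-1)/(k+1)) paths from s to t. *)
Require Import Defs.
From mathcomp Require Import all_boot all_order all_algebra.
From mathcomp Require Import perm.
From mathcomp Require Import reals sequences exp.
From mathcomp Require Import ring lra.

Set Implicit Arguments.
Unset Strict Implicit.
Unset Printing Implicit Defensive.

Import Order.TTheory GRing.Theory Num.Theory.

Local Open Scope ring_scope.

(** * Logarithms of factorials *)

Section Logarithms.
Variable R : realType.
Implicit Types (x y t m : R) (n : nat).

Lemma ln_le_subr1 x : 0 < x -> ln x <= x - 1.
Proof.
move=> x0; rewrite -ler_expR lnK // (le_trans _ (expR_ge1Dx _)) //.
by rewrite addrC subrK.
Qed.

Lemma ln_nat_ge0 n : 0 <= ln n%:R :> R.
Proof. by case: n => [|n]; [rewrite ln0 | rewrite ln_ge0 // ler1n]. Qed.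

(** The left side is the tangent line at [m] of the convex function [t * ln t]. *)
Lemma mul_ln_tangent t m : 0 <= t -> 0 < m -> t * ln m + t - m <= t * ln t.
Proof.
move=> t0 m0; have [->|tn0] := eqVneq t 0; first by lra.
have tp : 0 < t by rewrite lt_def tn0.
have := ln_le_subr1 (divr_gt0 m0 tp); rewrite ln_div ?posrE // => h.
have := ler_wpM2l t0 h.
rewrite !mulrBr mulr1 mulrCA divff // mulr1; lra.
Qed.

(** Jensen's inequality for [t * ln t], by summing the tangent inequality at the mean of the
    [t i]. *)
Lemma mul_ln_sum (I : finType) (K : pred I) (t : I -> R) :
  (forall i, 0 <= t i) ->
  (\sum_(i | K i) t i) * ln (\sum_(i | K i) t i) <=
  (\sum_(i | K i) t i) * ln #|K|%:R + \sum_(i | K i) t i * ln (t i).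
Proof.
move=> t0; set P := \sum_(i | K i) t i.
have P0 : 0 <= P by apply: sumr_ge0.
have [Pz|Pn0] := eqVneq P 0.
  rewrite Pz !mul0r add0r sumr_ge0 // => i Ki.
  suff -> : t i = 0 by rewrite mul0r.
  move/eqP: Pz; rewrite psumr_eq0 // => /allP/(_ i (mem_index_enum _)).
  by rewrite Ki => /eqP.
have Pp : 0 < P by rewrite lt_def Pn0.
have Kp : 0 < #|K|%:R :> R.
  rewrite ltr0n lt0n; apply: contra Pn0 => /eqP/card0_eq K0.
  by rewrite /P big_pred0.
have mp : 0 < P / #|K|%:R by apply: divr_gt0.
have : \sum_(i | K i) (t i * ln (P / #|K|%:R) + t i - P / #|K|%:R) <=
       \sum_(i | K i) t i * ln (t i).
  by apply: ler_sum => i _; apply: mul_ln_tangent.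
rewrite sumrB big_split /= -mulr_suml -/P sumr_const -[_ / _ *+ _]mulr_natr divfK ?gt_eqF //.
rewrite ln_div ?posrE // mulrBr; lra.
Qed.

(** The logarithm of [(n!)^(1/n)], the factor that a row with [n] ones contributes to the
    Bregman-Minc bound; it is 0 at [n = 0]. *)
Definition mean_ln_fact n : R := ln n`!%:R / n%:R.

Lemma mean_ln_factK n : n%:R * mean_ln_fact n = ln n`!%:R.
Proof.
case: n => [|n]; first by rewrite mul0r fact0 ln1.
by rewrite mulrC divfK // pnatr_eq0.
Qed.

Lemma ln_factS n : ln n.+1`!%:R = ln n.+1%:R + ln n`!%:R :> R.
Proof. by rewrite factS natrM lnM // posrE ltr0n // fact_gt0. Qed.

Lemma ln_fact_le n : ln n`!%:R <= n%:R * ln n.+1%:R :> R.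
Proof.
elim: n => [|n IH]; first by rewrite fact0 ln1 mul0r.
rewrite ln_factS addrC -[X in _ <= X * _]natr1 mulrDl mul1r.
have h : ln n.+1%:R <= ln n.+2%:R :> R.
  by rewrite ler_ln ?posrE ?ltr0n // ler_nat.
by apply: lerD => //; apply: le_trans IH _; rewrite ler_wpM2l.
Qed.

(** Passing from [n] to [n + 1] adds the term [ln (n + 1)], which is at least the mean of the
    earlier terms. *)
Lemma mean_ln_fact_homo : {homo mean_ln_fact : m n / (m <= n)%N >-> m <= n}.
Proof.
apply: homo_leq => [//|x y z|n]; first exact: le_trans.
have [->|n0] := posnP n.
  by rewrite /mean_ln_fact !(fact0, mul0r, ln1, invr0, divr1).
have np : 0 < n%:R :> R by rewrite ltr0n.
have sp : 0 < n.+1%:R :> R by rewrite ltr0n.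
rewrite /mean_ln_fact ler_pdivrMr // mulrAC ler_pdivlMr //.
rewrite ln_factS -[X in _ * X <= _]natr1 mulrDr mulr1 mulrDl addrC lerD2r.
by rewrite mulrC ln_fact_le.
Qed.

Lemma ln_succ_sub n : (0 < n)%N -> ln n.+1%:R - ln n%:R <= n%:R^-1 :> R.
Proof.
move=> n0; have np : 0 < n%:R :> R by rewrite ltr0n.
have sp : 0 < n.+1%:R :> R by rewrite ltr0n.
have := ln_le_subr1 (divr_gt0 sp np); rewrite ln_div ?posrE // => h.
apply: le_trans h _.
by rewrite -natr1 mulrDl mul1r divff ?gt_eqF // addrAC subrr add0r.
Qed.

Lemma ln_succ_sub_ge n : (0 < n)%N -> n.+1%:R^-1 <= ln n.+1%:R - ln n%:R :> R.
Proof.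
move=> n0; have np : 0 < n%:R :> R by rewrite ltr0n.
have sp : 0 < n.+1%:R :> R by rewrite ltr0n.
have := ln_le_subr1 (divr_gt0 np sp); rewrite ln_div ?posrE // => h.
suff -> : n.+1%:R^-1 = 1 - n%:R / n.+1%:R :> R.
  by rewrite -[leRHS]opprB lerNr opprB.
apply: (mulIf (lt0r_neq0 sp)); rewrite mulrBl divfK ?gt_eqF // mulVf ?gt_eqF //.
by rewrite mul1r -natr1 addrAC subrr add0r.
Qed.

(** This is [n! >= (n/e)^n]; the induction step amounts to [n (ln (n + 1) - ln n) <= 1]. *)
Lemma ln_fact_ge n : n%:R * ln n%:R - n%:R <= ln n`!%:R :> R.
Proof.
elim: n => [|n IH]; first by rewrite fact0 ln1 mul0r subrr.
have [->|n0] := posnP n; first by rewrite factS fact0 mul1n ln1 mulr0 sub0r oppr_le0.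
have np : 0 < n%:R :> R by rewrite ltr0n.
rewrite ln_factS.
have := ler_wpM2l (ltW np) (ln_succ_sub n0); rewrite divff ?gt_eqF // mulrBr.
rewrite -natr1 in IH *; move: IH; lra.
Qed.

(** This is [n! <= e n (n/e)^n]; the induction step amounts to
    [(n + 1) (ln (n + 1) - ln n) >= 1]. *)
Lemma ln_fact_le_stirling n : (0 < n)%N ->
  ln n`!%:R <= 1 + ln n%:R + n%:R * ln n%:R - n%:R :> R.
Proof.
case: n => // n _; elim: n => [|n IH]; first by rewrite factS fact0 mul1n ln1; lra.
have sp : 0 < n.+2%:R :> R by rewrite ltr0n.
rewrite ln_factS.
have := ler_wpM2l (ltW sp) (@ln_succ_sub_ge n.+1 isT).
rewrite divff ?gt_eqF // mulrBr.
rewrite -(natr1 n.+1); move: IH; lra.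
Qed.

End Logarithms.

(** * The Bregman-Minc inequality *)

Section BregmanMinc.
Variables (R : realType) (T : finType).
Implicit Types (a : rel T) (D : {set T}) (s : {perm T}).

Local Notation mlf := (@mean_ln_fact R).

(** With [a] read as a 0/1 matrix, the size of this set is the permanent of [a]. *)
Definition perms_in a : {set {perm T}} := [set s : {perm T} | [forall x, a x (s x)]].

(** Plays the part of the minor without row [i] and column [k], but keeps the index type [T], so
    that an induction can stay in one type. *)
Definition fix_entry a (i k : T) : rel T :=
  fun x y => if x == i then y == k else a x y && (y != k).

Lemma perms_inP a s : reflect (forall x, a x (s x)) (s \in perms_in a).
Proof. by rewrite inE; apply: forallP. Qed.

Lemma perms_in_fix_entry a i k s : a i k ->
  (s \in perms_in (fix_entry a i k)) = (s \in perms_in a) && (s i == k).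
Proof.
move=> aik; apply/perms_inP/andP => [h|[/perms_inP h /eqP sik] x].
  have sik : s i = k by apply/eqP; have := h i; rewrite /fix_entry eqxx.
  split; last by rewrite sik.
  apply/perms_inP => x; have := h x; rewrite /fix_entry.
  by case: eqP => [-> _|_ /andP[]//]; rewrite sik.
rewrite /fix_entry; case: eqVneq => [->|xi]; first by rewrite sik.
by rewrite h /= -sik (inj_eq perm_inj).
Qed.

Lemma card_fix_entry_row a i k j : j != i ->
  #|fix_entry a i k j| = (#|a j| - a j k)%N.
Proof.
move=> ji; rewrite (cardD1 k (a j)) /in_mem /= addnC addnK.
by apply: eq_card => y; rewrite /fix_entry !inE /in_mem /= (negPf ji) andbC.
Qed.

(** Grouping permutations by their value at [i] expands the permanent along row [i]. *)
Lemma perms_in_sum a i (F : T -> R) :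
  \sum_(s in perms_in a) F (s i) =
  \sum_(k | a i k) #|perms_in (fix_entry a i k)|%:R * F k.
Proof.
rewrite (partition_big (fun s : {perm T} => s i) (a i)) => [|s /perms_inP//].
apply: eq_bigr => k aik; rewrite mulr_natl -sumr_const.
by apply: eq_big => [s|s /andP[_ /eqP->//]]; rewrite perms_in_fix_entry.
Qed.

(** Jensen's inequality applied to the expansion of the permanent along row [i]. *)
Lemma card_perms_in_mul_ln a i :
  #|perms_in a|%:R * ln #|perms_in a|%:R <=
  \sum_(s in perms_in a)
     (ln #|a i|%:R + ln #|perms_in (fix_entry a i (s i))|%:R) :> R.
Proof.
rewrite big_split /= sumr_const -(mulr_natl (ln _)).
rewrite (perms_in_sum a i (fun k => ln #|perms_in (fix_entry a i k)|%:R)).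
have -> : #|perms_in a|%:R = \sum_(k | a i k) #|perms_in (fix_entry a i k)|%:R :> R.
  rewrite -sumr_const (perms_in_sum a i (fun=> 1)).
  by apply: eq_bigr => k _; rewrite mulr1.
exact: mul_ln_sum.
Qed.

(** Let row [j] have [r] entries. Of the other [i] in [D], exactly [r - 1] have [s i] in row [j] and
    cost it one entry; [#|D| - r] leave it intact. Then [ln r + ln (r - 1)! = ln r!] collects the
    terms. *)
Lemma sum_mean_ln_fact_row a D s j :
  s \in perms_in a -> j \in D ->
  (forall i x y, i \notin D -> a i y -> a x y -> x = i) ->
  ln #|a j|%:R + \sum_(i in D | i != j) mlf (#|a j| - a j (s i)) =
  #|D|%:R * mlf #|a j|.
Proof.
move=> /perms_inP sa jD Da; set r := #|a j|.
have ajsj : a j (s j) := sa j.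
(* [s] carries these indices onto the entries of row [j]: rows outside [D] share no entry with it,
   so no preimage lies outside [D]. *)
have rE : r = #|[set i in D | a j (s i)]|.
  rewrite /r -[RHS](card_imset _ (@perm_inj _ s)); apply: eq_card => y.
  apply/idP/imsetP => [|[x]]; last by rewrite inE => /andP[_ ?] ->.
  rewrite -topredE /= => ajy.
  exists (s^-1%g y); last by rewrite permKV.
  rewrite inE permKV ajy andbT; apply/negPn/negP => nD.
  have ay : a (s^-1%g y) y by rewrite -{2}(permKV s y).
  by have := Da _ j y nD ay ajy => jE; rewrite -jE jD in nD.
have rp : (0 < r)%N by rewrite rE card_gt0; apply/set0Pn; exists j; rewrite inE jD.
have rD : (r <= #|D|)%N.
  by rewrite rE subset_leq_card //; apply/subsetP => x; rewrite inE => /andP[].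
rewrite (bigID (fun i => a j (s i))) /=.
rewrite (eq_bigr (fun=> mlf r.-1)); last by move=> i /andP[_ ->]; rewrite subn1.
rewrite [X in _ + (_ + X)](eq_bigr (fun=> mlf r)); last first.
  by move=> i /andP[_ /negPf->]; rewrite subn0.
rewrite !sumr_const.
have -> : #|[pred i | (i \in D) && (i != j) & a j (s i)]| = r.-1.
  rewrite rE (cardsD1 j) inE jD ajsj /=.
  by apply: eq_card => x; rewrite !inE andbA; congr (_ && _); rewrite andbC.
have -> : #|[pred i | (i \in D) && (i != j) & ~~ a j (s i)]| = (#|D| - r)%N.
  rewrite rE -(cardsID [set i in D | a j (s i)] D).
  have -> : D :&: [set i in D | a j (s i)] = [set i in D | a j (s i)].
    by apply/setP => x; rewrite !inE andbA andbb.
  rewrite addKn; apply: eq_card => x; rewrite !inE.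
  by case: eqVneq => [->|_]; rewrite ?ajsj ?jD //; case: (x \in D); case: (a _ _).
rewrite -!(mulr_natl (mlf _)) mean_ln_factK addrA.
have -> : ln r%:R + ln (r.-1)`!%:R = r%:R * mlf r.
  by rewrite mean_ln_factK -[in RHS](prednK rp) ln_factS prednK.
by rewrite natrB // -mulrDl addrC subrK.
Qed.

(* Schrijver's averaging argument. The rows outside [D] are already decided:
   their single entry is shared with no other row. *)
Lemma ln_card_perms_in_undecided a D :
  (forall i k k', i \notin D -> a i k -> a i k' -> k = k') ->
  (forall i j k, i \notin D -> a i k -> a j k -> j = i) ->
  (0 < #|perms_in a|)%N ->
  ln #|perms_in a|%:R <= \sum_(i in D) mlf #|a i|.
Proof.
have [n] := ubnP #|D|; elim: n => // n IH in a D * => Dn a1 a2 P0.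
have [D0|Dp] := posnP #|D|.
  have {}D0 : D = set0 by apply: cards0_eq.
  rewrite D0 big_set0 -ln1 ler_ln ?posrE ?ltr0n // lern1.
  apply/card_le1_eqP => s t /perms_inP hs /perms_inP ht; apply/permP => x.
  by apply: (a1 x); rewrite ?D0 ?inE.
have P0R : 0 < #|perms_in a|%:R :> R by rewrite ltr0n.
have D0R : 0 < #|D|%:R :> R by rewrite ltr0n.
(* Scaling by [#|D|] and [#|perms_in a|] turns the claim into a sum over all pairs of a row [i] in
   [D] and a permutation [s]. *)
rewrite -(ler_pM2l P0R) -(ler_pM2l D0R) mulr_natl -sumr_const.
apply: le_trans (ler_sum _ (fun i _ => card_perms_in_mul_ln a i)) _.
rewrite exchange_big /= mulrA [_ * #|_|%:R]mulrC -mulrA mulr_natl -sumr_const.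
apply: ler_sum => s sP; have sa := perms_inP _ _ sP.
(* By the counting identity the terms [ln #|a j|] cancel; for each [i] there remains the induction
   hypothesis with [i] removed from [D] and the entry [(i, s i)] fixed. *)
rewrite mulr_sumr -(eq_bigr _ (fun j jD => sum_mean_ln_fact_row sP jD a2)).
rewrite [leRHS]big_split /= big_split /= lerD2l.
rewrite (exchange_big_dep (fun i => i \in D)) /=; last by move=> i j _ /andP[].
apply: ler_sum => i iD.
apply: le_trans (IH (fix_entry a i (s i)) (D :\ i) _ _ _ _) _.
- by move: Dn; rewrite (cardsD1 i) iD add1n ltnS.
- move=> x k k'; rewrite !inE negb_and negbK /fix_entry.
  case: eqP => [_ _ /eqP-> /eqP-> //|_ /= xD /andP[h1 _] /andP[h2 _]].
  exact: a1 h1 h2.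
- move=> x j k; rewrite !inE negb_and negbK /fix_entry.
  case: (eqVneq x i) => [-> _ /eqP->|xi /= xD /andP[h1 h2]].
    by case: (eqVneq j i) => // _; rewrite eqxx andbF.
  case: (eqVneq j i) => [_ kE|_ /andP[h3 _]]; last exact: a2 h1 h3.
  by rewrite kE in h2.
- by apply/card_gt0P; exists s; rewrite perms_in_fix_entry // sP eqxx.
rewrite le_eqVlt; apply/orP; left; apply/eqP.
apply: eq_big => [j|j]; first by rewrite !inE iD /= andbC eq_sym.
by rewrite !inE => /andP[ji _]; rewrite card_fix_entry_row.
Qed.

Theorem bregman_minc a : (0 < #|perms_in a|)%N ->
  ln #|perms_in a|%:R <= \sum_i mlf #|a i|.
Proof.
move=> P0; rewrite (eq_bigl (mem [set: T])) => [|i]; last by rewrite !inE.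
by apply: ln_card_perms_in_undecided => // i; rewrite ?inE.
Qed.

End BregmanMinc.

(** * Counting orbits of a function *)

Section Orbits.
Variable T : finType.
Implicit Types (f g : T -> T) (s t x : T) (nb : rel T).

Definition orbit_last f s : T := iter (order f s).-1 f s.

(** An iterate below [order f s] sits in the orbit list at the position given by its exponent, so
    [next] departs from [f] only when it wraps around at the end. *)
Lemma next_orbit f s x : x \in orbit f s ->
  next (orbit f s) x = if x == orbit_last f s then s else f x.
Proof.
move=> xo; rewrite next_nth xo /orbit_last.
have := xo; rewrite -fconnect_orbit => /iter_findex xE.
have := findex_max (etrans (fconnect_orbit f s x) xo).
move: (findex f s x) xE => i <- {x xo} io.
have iE j : (j < order f s)%N -> index (iter j f s) (orbit f s) = j.
  move=> jo; rewrite -(nth_traject f jo s) index_uniq ?size_traject //.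
  exact: orbit_uniq.
have eqE j : (j < order f s)%N -> (iter i f s == iter j f s) = (i == j).
  by move=> jo; apply/eqP/eqP => [e|->//]; rewrite -(iE i) // e iE.
rewrite iE // eqE ?ltn_predL ?order_gt0 //.
rewrite /orbit -orderSpred /=; case: ltngtP => [il|il|->].
- by rewrite (set_nth_default (f s)) ?size_traject // nth_traject // -iterSr.
- by move: io; rewrite -(orderSpred f s) ltnS leqNgt il.
- by rewrite nth_default // size_traject.
Qed.

Lemma next_orbit_inj f s : injective (next (orbit f s)).
Proof. exact: can_inj (prev_next (orbit_uniq f s)). Qed.

(** The simple path from [s] closed into a cycle, with all other points fixed. *)
Definition orbit_perm f s : {perm T} := perm (@next_orbit_inj f s).

Lemma orbit_permE f s x : x \in orbit f s ->
  orbit_perm f s x = if x == orbit_last f s then s else f x.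
Proof. by rewrite permE; apply: next_orbit. Qed.

Lemma orbit_perm_out f s x : x \notin orbit f s -> orbit_perm f s x = x.
Proof. by rewrite permE next_nth => /negPf->. Qed.

Lemma orbit_last_in f s : orbit_last f s \in orbit f s.
Proof. by rewrite -fconnect_orbit fconnect_iter. Qed.

(** Undoes the closing of the cycle: with [t] the last point and [y] its true image, this follows
    [f] along the orbit. *)
Definition orbit_step t y (p : {perm T}) x : T := if x == t then y else p x.

Lemma iter_orbit_perm f s i : iter i f s =
  iter i (orbit_step (orbit_last f s) (f (orbit_last f s)) (orbit_perm f s)) s.
Proof.
elim: i => //= i <-; rewrite /orbit_step.
case: eqP => [<-//|/eqP/negPf ne]; rewrite orbit_permE ?ne //.
by rewrite -fconnect_orbit fconnect_iter.
Qed.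

(** The closed path, its last point and the image of that point encode the whole trajectory of
    [s]. *)
Lemma iter_orbit_perm_eq f g s i :
  orbit_perm f s = orbit_perm g s -> orbit_last f s = orbit_last g s ->
  f (orbit_last f s) = g (orbit_last g s) -> iter i f s = iter i g s.
Proof.
move=> ep el e; apply: etrans (iter_orbit_perm f s i) _.
by rewrite e el ep -iter_orbit_perm.
Qed.

(** The diagonal admits the points off the path; row [t] holds only the closing entry. *)
Definition path_rel nb s t : rel T :=
  fun x y => if x == t then y == s else (y == x) || nb x y.

Lemma orbit_perm_path_rel nb f s : (forall x, nb x (f x)) ->
  orbit_perm f s \in perms_in (path_rel nb s (orbit_last f s)).
Proof.
move=> nbf; apply/perms_inP => x; rewrite /path_rel.
have [xo|xo] := boolP (x \in orbit f s).
  by rewrite orbit_permE //; case: (x == _) => //; rewrite nbf orbT.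
rewrite orbit_perm_out // eqxx; case: eqP => // xE.
by rewrite xE orbit_last_in in xo.
Qed.

(** The bound is [((k+1)!)^((#|T| - 1)/(k+1))]: row [t] contributes the factor 1, and every other
    row has at most [k] neighbours plus the diagonal. *)
Lemma card_perms_in_path_rel (R : realType) nb s t k :
  (forall x, #|nb x| <= k)%N ->
  #|perms_in (path_rel nb s t)|%:R <=
    expR ((#|T|%:R - 1) * mean_ln_fact R k.+1).
Proof.
move=> nbk; have [->|P0] := posnP #|perms_in (path_rel nb s t)|.
  exact: expR_ge0.
rewrite -[leLHS]lnK ?posrE ?ltr0n // ler_expR.
apply: le_trans (bregman_minc R P0) _; rewrite (bigD1 t) //=.
have -> : #|path_rel nb s t t| = 1%N.
  by rewrite -(card1 s); apply: eq_card => y; rewrite /path_rel -!topredE /= eqxx.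
have -> : mean_ln_fact R 1 = 0 by rewrite /mean_ln_fact factS fact0 mul1n ln1 mul0r.
rewrite add0r.
apply: (@le_trans _ _ (\sum_(i | i != t) mean_ln_fact R k.+1)).
  apply: ler_sum => x xt; apply: mean_ln_fact_homo.
  apply: leq_trans (_ : #|predU1 x (nb x)| <= _)%N.
    apply: subset_leq_card; apply/subsetP => y.
    by rewrite /path_rel -!topredE /= (negPf xt).
  by rewrite cardU1; case: (_ \notin _); rewrite ?add1n ?add0n ?ltnS ?nbk // leqW.
rewrite sumr_const cardC1 -[_ *+ _.-1]mulr_natl -subn1 natrB //.
by apply/card_gt0P; exists t.
Qed.

End Orbits.

(** * Max-gain runs *)

Section DeterministicMDP.
Variables (R : realType) (S A : finType) (M : mdp R S A).
Implicit Types (pi : policy S A) (V : S -> R) (s x : S) (a b : A).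

(** * Policy improvement in an arbitrary MDP *)

Lemma valueP pi s : value M pi s = backup M (value M pi) s (pi s).
Proof. exact: (proj2 (is_valueE M pi _) erefl s). Qed.

Lemma switchP pi I x : valid_improvement M pi I ->
  (switch pi I x = pi x /\ forall a, (x, a) \notin I) \/
  (x, switch pi I x) \in I.
Proof.
move=> [_ _ Iu]; rewrite ffunE; case: pickP => [a aI|none]; first by right.
by left; split => // a; rewrite none.
Qed.

Lemma gain_stay pi s : gain M pi s (pi s) = 0.
Proof. by rewrite /gain /qvalue -valueP subrr. Qed.

Lemma gain_switch_ge0 pi I s : valid_improvement M pi I ->
  0 <= gain M pi s (switch pi I s).
Proof.
move=> vI; have [[-> _]|sI] := switchP s vI; first by rewrite gain_stay.
by have [_ /subsetP/(_ _ sI)] := vI; rewrite inE => /ltW.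
Qed.

Lemma backup_diff V W s a :
  backup M V s a - backup M W s a =
  discount M * \sum_s' trans M s a s' * (V s' - W s').
Proof.
rewrite /backup opprD addrACA subrr add0r -mulrBr -sumrB.
by congr (_ * _); apply: eq_bigr => t _; rewrite mulrBr.
Qed.

(** A minimum principle: where the difference [d] of the values is least, it is at least
    [discount M] times an average of [d], hence at least [discount M] times itself, and so
    nonnegative. *)
Lemma value_le_of_gain_ge0 pi pi' :
  (forall s, 0 <= gain M pi s (pi' s)) -> forall s, value M pi s <= value M pi' s.
Proof.
move=> g0 s0; pose d s := value M pi' s - value M pi s.
have [s _ smin] := arg_minP (P := predT) d (erefl : predT s0).
suff ds : 0 <= d s by rewrite -subr_ge0 (le_trans ds (smin _ isT)).
have h : discount M * d s <= d s.
  have : discount M * \sum_s' trans M s (pi' s) s' * d s' <= d s.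
    rewrite -backup_diff -valueP /d lerD2l lerN2 -subr_ge0; exact: g0.
  apply: le_trans; apply: ler_wpM2l; first exact: discount_ge0.
  rewrite -[leLHS]mul1r -(trans_sum1 M s (pi' s)) mulr_suml.
  by apply: ler_sum => t _; apply: ler_wpM2l; [exact: trans_ge0 | exact: smin].
have h1 : 0 < 1 - discount M by rewrite subr_gt0 discount_lt1.
by rewrite -(pmulr_rge0 _ h1) mulrBl mul1r subr_ge0.
Qed.

(** By monotonicity the new value at [s] is at least the old action value of [pi' s]. *)
Lemma value_lt_of_gain_gt0 pi pi' s :
  (forall s, 0 <= gain M pi s (pi' s)) -> 0 < gain M pi s (pi' s) ->
  value M pi s < value M pi' s.
Proof.
move=> g0; rewrite subr_gt0 => /lt_le_trans; apply.
rewrite (valueP pi' s) -subr_ge0 backup_diff mulr_ge0 ?discount_ge0 //.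
apply: sumr_ge0 => t _; rewrite mulr_ge0 ?trans_ge0 // subr_ge0.
exact: value_le_of_gain_ge0.
Qed.

Lemma step_value_le pi pi' s : max_gain_step M pi pi' ->
  value M pi s <= value M pi' s.
Proof.
by move=> [I [vI _ ->]]; apply: value_le_of_gain_ge0 => x; apply: gain_switch_ge0.
Qed.

Lemma step_value_lt pi pi' : max_gain_step M pi pi' ->
  exists s, value M pi s < value M pi' s.
Proof.
move=> [I [vI _ ->]]; have [/set0Pn[[s a] saI] Iimp _] := vI; exists s.
apply: value_lt_of_gain_gt0 => [x|]; first exact: gain_switch_ge0.
have [[_ /(_ a)]|sI] := switchP s vI; first by rewrite saI.
by have := subsetP Iimp _ sI; rewrite inE.
Qed.

(** * Deterministic transitions and settled states *)

Hypothesis detM : deterministic M.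

(** The default [s] never occurs: a row of zeros and ones with sum one contains a one. *)
Definition succ s a : S := odflt s [pick y | trans M s a y == 1].

Lemma trans_succ s a y : trans M s a y = (y == succ s a)%:R.
Proof.
have tr z : trans M s a z = (trans M s a z == 1)%:R.
  by have [->|->] := detM s a z; rewrite ?eqxx // eq_sym oner_eq0.
rewrite /succ; case: pickP => [z /eqP z1 /=|none]; last first.
  have := trans_sum1 M s a; rewrite big1 => [/eqP|z _].
    by rewrite eq_sym oner_eq0.
  by rewrite tr none.
have [->//|yz] := eqVneq y z; rewrite tr; case: eqP => // y1.
have := trans_sum1 M s a; rewrite (bigD1 z) //= (bigD1 y) //= z1 y1 => e.
have : 0 <= \sum_(i | (i != z) && (i != y)) trans M s a i.
  by apply: sumr_ge0 => i _; apply: trans_ge0.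
by move: e; lra.
Qed.

Lemma backup_succ V s a : backup M V s a = reward M s a + discount M * V (succ s a).
Proof.
congr (_ + _ * _); rewrite (bigD1 (succ s a)) //= trans_succ eqxx mul1r.
by rewrite big1 ?addr0 // => y /negPf ne; rewrite trans_succ ne mul0r.
Qed.

Definition policy_succ pi s : S := succ s (pi s).

(** Contraction along the common trajectory: the largest difference of the two values on it is at
    most [discount M] times itself. *)
Lemma value_eq_orbit pi pi' s :
  (forall i, iter i (policy_succ pi) s = iter i (policy_succ pi') s) ->
  (forall i, let x := iter i (policy_succ pi) s in
     reward M x (pi x) = reward M x (pi' x)) ->
  value M pi s = value M pi' s.
Proof.
set f := policy_succ pi; set f' := policy_succ pi' => ff' rr'.
pose d x := `|value M pi x - value M pi' x|.
have dE x : fconnect f s x -> d x = discount M * d (f x).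
  move=> /iter_findex <-; set i := findex _ _ _; have := rr' i => /= rE.
  rewrite /d valueP (valueP pi') !backup_succ rE opprD addrACA subrr add0r.
  have -> : succ (iter i f s) (pi' (iter i f s)) = f (iter i f s).
    by have := ff' i.+1; rewrite /= -ff' => ->.
  by rewrite -mulrBr normrM ger0_norm ?discount_ge0.
have [x sx xmax] := arg_maxP (P := fconnect f s) d (connect0 _ s).
have dx : d x <= discount M * d x.
  rewrite {1}dE // ler_wpM2l ?discount_ge0 //; apply: xmax.
  exact: connect_trans sx (fconnect1 _ _).
have h1 : 0 < 1 - discount M by rewrite subr_gt0 discount_lt1.
have dx0 : d x <= 0 by rewrite -(pmulr_rle0 _ h1) mulrBl mul1r subr_le0.
apply/eqP; rewrite -subr_eq0 -normr_le0; apply: le_trans dx0.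
exact: xmax (connect0 _ _).
Qed.

(* Max-gain switching only produces settled states, so along a run a state
   that is not settled still carries its initial action. *)
Definition settled pi : {set S} :=
  [set x | [forall b, (succ x b == succ x (pi x)) ==>
                      (reward M x b <= reward M x (pi x))]].

Lemma settledP pi x :
  reflect (forall b, succ x b = succ x (pi x) -> reward M x b <= reward M x (pi x))
          (x \in settled pi).
Proof.
rewrite inE; apply: (iffP forallP) => h b; first by move=> /eqP e; exact: implyP (h b) e.
by apply/implyP => /eqP; apply: h.
Qed.

Lemma settled_reward pi pi' x : x \in settled pi -> x \in settled pi' ->
  policy_succ pi x = policy_succ pi' x -> reward M x (pi x) = reward M x (pi' x).
Proof.
move=> /settledP h /settledP h' e; apply/eqP; rewrite eq_le h ?h' //.
Qed.

(** Gains of actions with the same successor differ only by their rewards, so a max-gain action has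
    the largest reward among them. *)
Lemma step_settled pi pi' x : max_gain_step M pi pi' ->
  pi' x = pi x \/ x \in settled pi'.
Proof.
move=> [I [vI mI ->]]; have [[e _]|xI] := switchP x vI; first by left.
right; apply/settledP => b e; have := mI _ _ xI b.
by rewrite /gain /qvalue lerD2r !backup_succ e lerD2r.
Qed.

Lemma step_settled_sub pi pi' : max_gain_step M pi pi' ->
  settled pi \subset settled pi'.
Proof.
move=> st; apply/subsetP => x; have [e|//] := step_settled x st.
by rewrite !inE e.
Qed.

Definition reachable : rel S := fun x y => [exists a, succ x a == y].

Lemma card_reachable x : (#|reachable x| <= #|A|)%N.
Proof.
rewrite -cardsT (leq_trans _ (leq_imset_card (succ x) [set: A])) //.
apply: subset_leq_card; apply/subsetP => y /existsP[a /eqP <-].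
exact: imset_f.
Qed.

(** * Injective coding of the policies of a run *)

Section Run.
Variables (m : nat) (p : nat -> policy S A).
Hypothesis steps : forall t, (t < m)%N -> max_gain_step M (p t) (p t.+1).

Lemma run_value_le i j s : (i <= j <= m)%N -> value M (p i) s <= value M (p j) s.
Proof.
move=> /andP[]; elim: j => [|j IH]; first by rewrite leqn0 => /eqP->.
rewrite leq_eqVlt => /predU1P[->//|ij] jm.
exact: le_trans (IH ij (ltnW jm)) (step_value_le s (steps jm)).
Qed.

Lemma run_settled_sub i j : (i <= j <= m)%N -> settled (p i) \subset settled (p j).
Proof.
move=> /andP[]; elim: j => [|j IH]; first by rewrite leqn0 => /eqP->.
rewrite leq_eqVlt => /predU1P[->//|ij] jm.
exact: subset_trans (IH ij (ltnW jm)) (step_settled_sub (steps jm)).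
Qed.

(** A switch settles its state for good, so a state still unsettled at [j] was not switched between
    [i] and [j]. *)
Lemma run_settled i j x : (i <= j <= m)%N -> x \notin settled (p j) -> p j x = p i x.
Proof.
move=> /andP[]; elim: j => [|j IH]; first by rewrite leqn0 => /eqP->.
rewrite leq_eqVlt => /predU1P[->//|ij] jm xj.
have [->|] := step_settled x (steps jm); last by rewrite (negPf xj).
apply: IH => //; first exact: ltnW.
exact: contra (subsetP (step_settled_sub (steps jm)) x) xj.
Qed.

(** Such a state exists for [i < m]. Index [m] is coded too, but there any choice will do: comparing
    two codes uses the improvement at the smaller index only. *)
Definition improved_state (s0 : S) i : S :=
  odflt s0 [pick s | value M (p i) s < value M (p i.+1) s].

Definition run_code s0 i : 'I_#|S|.+1 * S * S * A * {perm S} :=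
  let s := improved_state s0 i in
  let t := orbit_last (policy_succ (p i)) s in
  (inord #|settled (p i)|, s, t, p i t, orbit_perm (policy_succ (p i)) s).

Lemma run_code_neq s0 i j : (i < j <= m)%N -> run_code s0 i <> run_code s0 j.
Proof.
move=> /andP[ij jm]; have im : (i < m)%N := leq_trans ij jm.
rewrite /run_code; set s := improved_state s0 i.
have ss : value M (p i) s < value M (p i.+1) s.
  rewrite /s /improved_state; case: pickP => //= none.
  by have [x] := step_value_lt (steps im); rewrite none.
move=> [eW es et ea ep].
(* The settled sets are nested, so their size identifies them; it is at most [#|S|], so [inord]
   loses nothing. *)
have {}eW : settled (p i) = settled (p j).
  apply/eqP; rewrite eqEcard run_settled_sub ?(ltnW ij) //=.
  move/(congr1 val): eW; rewrite /= !inordK ?ltnS ?max_card // => ->.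
  exact: leqnn.
have lt_ij := lt_le_trans ss (run_value_le s (introT andP (conj ij jm))).
suff e : value M (p i) s = value M (p j) s by rewrite e ltxx in lt_ij.
rewrite -es in et ea ep.
have it k : iter k (policy_succ (p i)) s = iter k (policy_succ (p j)) s.
  by apply: iter_orbit_perm_eq => //; rewrite /policy_succ ea et.
apply: value_eq_orbit => // k; set x := iter k _ s => /=.
(* At a settled state the reward is fixed by the successor; at an unsettled one the action itself is
   unchanged. *)
have [xW|xW] := boolP (x \in settled (p i)).
  apply: settled_reward; rewrite -?eW //.
  by rewrite -[LHS]/(iter k.+1 _ s) it /= -it.
by rewrite -(run_settled (i := i) (j := j)) -?eW ?(ltnW ij).
Qed.

(** The [m + 1] codes are distinct: the first four components give [(n + 1) n^2 k] choices, and
    Bregman-Minc bounds the permutations for each. *)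
Lemma run_length : (0 < #|S|)%N ->
  m.+1%:R <= step_bound R #|S| #|A|.
Proof.
move=> /card_gt0P[s0 _].
pose X := [set u : 'I_#|S|.+1 * S * S * A * {perm S} |
  u.2 \in perms_in (path_rel reachable u.1.1.1.2 u.1.1.2)].
have inX i : run_code s0 i \in X.
  rewrite inE; apply: orbit_perm_path_rel => x.
  by apply/existsP; exists (p i x).
have inj : injective (fun i : 'I_m.+1 => run_code s0 i).
  move=> i j e; apply/val_inj; case: (ltngtP i j) => // h.
    by case: (@run_code_neq s0 i j); rewrite // h -ltnS ltn_ord.
  by case: (@run_code_neq s0 j i); rewrite // h -ltnS ltn_ord.
have mX : (m.+1 <= #|X|)%N.
  rewrite -[leqLHS](card_ord m.+1) -[leqLHS]cardsT -[leqLHS](card_imset _ inj).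
  by apply: subset_leq_card; apply/subsetP => u /imsetP[i _ ->].
apply: (@le_trans _ _ #|X|%:R); first by rewrite ler_nat.
rewrite -sum1_card natr_sum.
rewrite (eq_bigl (fun u => predT u.1 && (u.2 \in perms_in (path_rel reachable u.1.1.1.2 u.1.1.2))));
  last by move=> u; rewrite inE.
rewrite -(pair_big_dep predT
  (fun u v => v \in perms_in (path_rel reachable u.1.1.2 u.1.2)) (fun _ _ => 1%:R)) /=.
pose B := expR ((#|S|%:R - 1) * mean_ln_fact R #|A|.+1).
apply: (@le_trans _ _ (\sum_(u : 'I_#|S|.+1 * S * S * A) B)).
  apply: ler_sum => u _; rewrite sumr_const.
  exact: card_perms_in_path_rel card_reachable.
rewrite sumr_const !card_prod card_ord -mulr_natl !natrM.
rewrite /step_bound /powR pnatr_eq0 gtn_eqF ?fact_gt0 //.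
have -> : (#|S|%:R - 1) / (#|A|%:R + 1) * ln (#|A|.+1)`!%:R =
    (#|S|%:R - 1) * mean_ln_fact R #|A|.+1 by rewrite mulrAC -mulrA natr1.
by rewrite -/B -[#|S|.+1%:R]natr1 expr2 !mulrA.
Qed.

End Run.

Lemma max_gain_run_nth (r : seq (policy S A)) pi0 : max_gain_run M r ->
  (0 < size r)%N /\
  forall t, (t < (size r).-1)%N -> max_gain_step M (nth pi0 r t) (nth pi0 r t.+1).
Proof.
elim=> [pi _|pi pi' {}r st _ [_ IH]]; first by [].
by split=> // -[|t] //= tr; apply: IH.
Qed.

End DeterministicMDP.

(** * The asymptotic form of the bound *)

Section Asymptotics.
Variable R : realType.
Implicit Types (n k : nat).

Lemma ln2_gt0 : 0 < ln 2 :> R.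
Proof. by rewrite ln_gt0 // ltr1n. Qed.

(** Chosen so that [1 + e (1 + ln (k + 1)) <= asym_const * ln k] for [k >= 2], using
    [1 <= ln k / ln 2] and [ln (k + 1) <= 2 ln k]. *)
Definition asym_const : R := (1 + expR 1) / ln 2 + 2 * expR 1.

(** From [exp (- x) >= 1 - x] follows [exp x <= 1 + x exp x], and [exp x <= e] on the unit
    interval. *)
Lemma expR_le_mul x : 0 <= x -> x <= 1 -> expR x <= 1 + expR 1 * x :> R.
Proof.
move=> x0 x1; have h := expR_ge1Dx (- x).
have := ler_wpM2l (expR_ge0 x) h; rewrite -expRD subrr expR0.
have : expR x * x <= expR 1 * x by rewrite ler_wpM2r // ler_expR.
lra.
Qed.

Lemma mean_ln_fact_ge m : (0 < m)%N -> ln m%:R - 1 <= mean_ln_fact R m.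
Proof.
move=> m0; have mp : 0 < m%:R :> R by rewrite ltr0n.
rewrite -(ler_pM2l mp) mean_ln_factK mulrBr mulr1; exact: ln_fact_ge.
Qed.

(** The upper Stirling bound at [k + 1] gives [exp x (k + 1)/e] with the small error exponent
    [x = (1 + ln (k + 1))/(k + 1)], which is then linearised. *)
Lemma expR_mean_ln_fact_le k : (2 <= k)%N ->
  expR (mean_ln_fact R k.+1) <=
  (1 + asym_const * (ln k%:R / k%:R)) * (k%:R / expR 1).
Proof.
move=> k2; have k0 : (0 < k)%N by apply: leq_trans k2.
have kp : 0 < k%:R :> R by rewrite ltr0n.
have mp : 0 < k.+1%:R :> R by rewrite ltr0n.
have e0 := expR_gt0 (1 : R).
pose l : R := ln k.+1%:R; pose x := (1 + l) / k.+1%:R.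
have l0 : 0 <= l by apply: ln_nat_ge0.
have x0 : 0 <= x by rewrite /x divr_ge0 ?addr_ge0.
have x1 : x <= 1.
  rewrite /x ler_pdivrMr // mul1r.
  by have := ln_le_subr1 mp; rewrite -/l; lra.
have hm : mean_ln_fact R k.+1 <= x + (l - 1).
  rewrite -(ler_pM2l mp) mean_ln_factK mulrDr /x [_ * (_ / _)]mulrC divfK ?gt_eqF //.
  by have := @ln_fact_le_stirling R k.+1 isT; rewrite -/l mulrBr mulr1; lra.
have h1 : expR (mean_ln_fact R k.+1) <= expR x * (k.+1%:R / expR 1).
  apply: (@le_trans _ _ (expR (x + (l - 1)))); first by rewrite ler_expR.
  by rewrite expRD expRB /l lnK ?posrE.
apply: le_trans h1 _.
rewrite [leRHS]mulrA [leLHS]mulrA ler_pM2r ?invr_gt0 //.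
apply: (@le_trans _ _ ((1 + expR 1 * x) * k.+1%:R)).
  by rewrite ler_wpM2r ?(ltW mp) // expR_le_mul.
have -> : (1 + expR 1 * x) * k.+1%:R = k%:R + 1 + expR 1 * (1 + l).
  by rewrite mulrDl mul1r -mulrA /x divfK ?gt_eqF // natr1.
have -> : (1 + asym_const * (ln k%:R / k%:R)) * k%:R = k%:R + asym_const * ln k%:R.
  by rewrite mulrDl mul1r -mulrA divfK ?gt_eqF.
(* Because [k + 1 <= k^2] for [k >= 2]. *)
have ll : l <= 2 * ln k%:R.
  rewrite mulr_natl -lnXn // /l ler_ln ?posrE ?exprn_gt0 // -natrX ler_nat.
  by rewrite -mulnn (leq_trans _ (leq_mul k2 (leqnn k))) // mul2n -addnn -addn1 leq_add2l.
have l2 : ln 2 <= ln k%:R :> R by rewrite ler_ln ?posrE // ler_nat.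
have l2' : 1 <= ln k%:R / ln 2 :> R by rewrite ler_pdivlMr ?ln2_gt0 // mul1r.
rewrite /asym_const mulrDl -mulrA [(ln 2)^-1 * _]mulrC.
have h2 := ler_wpM2l (ltW e0) ll.
have e1 : 0 <= 1 + expR 1 :> R by lra.
have h3 := ler_wpM2l e1 l2'.
move: h2 h3; lra.
Qed.

(** With [G = ((k+1)!)^(1/(k+1))] the power is [G^n / G]. The spare factor [k / G] is at most [e]
    since [G >= (k + 1)/e]; with [n + 1 <= 2 n] this yields the constant [2 e]. *)
Lemma step_bound_asymptotic n k : (2 <= n)%N -> (2 <= k)%N ->
  step_bound R n k <= 2 * expR 1 * n%:R ^+ 3 *
    ((1 + asym_const * (ln k%:R / k%:R)) * (k%:R / expR 1)) ^+ n.
Proof.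
move=> n2 k2; have kp : 0 < k%:R :> R by rewrite ltr0n (leq_trans _ k2).
have np : 0 < n%:R :> R by rewrite ltr0n (leq_trans _ n2).
have mp : 0 < k.+1%:R :> R by rewrite ltr0n.
set G := expR (mean_ln_fact R k.+1).
have G0 : 0 < G by apply: expR_gt0.
have powE : (k.+1)`!%:R `^ ((n%:R - 1) / (k%:R + 1)) = G ^+ n / G.
  rewrite /powR pnatr_eq0 gtn_eqF ?fact_gt0 // /G -expRM_natl -expRB.
  by congr expR; rewrite natr1 -mulrA [_^-1 * _]mulrC -/(mean_ln_fact R k.+1) mulrBl mul1r.
have kG : k%:R / G <= expR 1.
  rewrite ler_pdivrMr // /G -expRD.
  have := @mean_ln_fact_ge k.+1 isT => h.
  apply: (@le_trans _ _ (expR (ln k.+1%:R))); last by rewrite ler_expR; lra.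
  by rewrite lnK ?posrE // ler_nat.
have nn : n%:R + 1 <= 2 * n%:R :> R.
  have : 1 <= n%:R :> R by rewrite ler1n (leq_trans _ n2).
  lra.
have GH := expR_mean_ln_fact_le k2; rewrite -/G in GH.
rewrite /step_bound powE.
apply: (@le_trans _ _ (2 * expR 1 * n%:R ^+ 3 * G ^+ n)); last first.
  rewrite ler_wpM2l //; last by rewrite lerXn2r // nnegrE ?(le_trans (ltW G0)) // ltW.
  by rewrite !mulr_ge0 ?expR_ge0 ?exprn_ge0.
have -> : (n%:R + 1) * n%:R ^+ 2 * k%:R * (G ^+ n / G) =
          (n%:R + 1) * (k%:R / G) * (n%:R ^+ 2 * G ^+ n) by ring.
have -> : 2 * expR 1 * n%:R ^+ 3 * G ^+ n =
          2 * n%:R * expR 1 * (n%:R ^+ 2 * G ^+ n) by ring.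
rewrite ler_wpM2r ?mulr_ge0 ?exprn_ge0 ?(ltW G0) //.
by rewrite ler_pM // ?addr_ge0 // divr_ge0 // ltW.
Qed.

End Asymptotics.

Theorem corollary2 (R : realType) :
  (forall (n k : nat) (S A : finType) (M : mdp R S A),
      (2 <= n)%N -> (2 <= k)%N -> #|S| = n -> #|A| = k -> deterministic M ->
      ~ (exists p : nat -> policy S A,
           forall t : nat, max_gain_step M (p t) (p t.+1)) /\
      (forall s : seq (policy S A),
         max_gain_run M s -> (size s)%:R <= step_bound R n k)) /\
  (exists C c : R, 0 < C /\ 0 < c /\
     forall n k : nat, (2 <= n)%N -> (2 <= k)%N ->
       step_bound R n k <=
         C * n%:R ^+ 3 *
         ((1 + c * (ln k%:R / k%:R)) * (k%:R / expR 1)) ^+ n).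
Proof.
split=> [n k S A M n2 k2 nS kA detM|].
  have S0 : (0 < #|S|)%N by rewrite nS (leq_trans _ n2).
  subst n k; split=> [[p steps]|r run].
    (* Cutting an infinite run after [b] steps leaves [b + 1] policies, more than the bound
       allows. *)
    pose b := Num.trunc (step_bound R #|S| #|A|).
    have := @run_length R S A M detM b p (fun t _ => steps t) S0.
    by apply/negP; rewrite -ltNge truncnS_gt.
  have [pi0] : exists pi0 : policy S A, True by case: run => [pi|pi]; exists pi.
  move=> _; have [r0 steps] := max_gain_run_nth pi0 run.
  by have := run_length detM steps S0; rewrite prednK.
exists (2 * expR 1), (asym_const R); split; last split.
- by rewrite mulr_gt0 ?expR_gt0.
- have e0 := expR_gt0 (1 : R).
  by rewrite /asym_const addr_gt0 ?divr_gt0 ?ln2_gt0 // ?mulr_gt0 // addr_gt0.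
- by move=> n k; apply: step_bound_asymptotic.
Qed.
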